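(* Let $K$ be a field with $\mathrm{char}(K)\neq 2$ (characteristic $5$ allowed) and let $E$ be an elliptic curve over $K$. The following are equivalent: (i) $E(K)$ contains a subgroup isomorphic to $\mathbb{Z}/10\mathbb{Z}\oplus\mathbb{Z}/2\mathbb{Z}$; (ii) there exist $(\xi,\eta)\in K^2$ with $\eta^2=\xi(\xi^2+\xi-1)$ and $(\xi,\eta)\notin\{(0,0),(\pm1,\pm1)\}\cup\{(\xi,0):\xi^2+\xi-1=0\}$, such that $E$ is isomorphic (over $K$) to the cubic curve $$\mathcal{E}_{5,\xi,\eta}: y^2=\left[x+\left(\frac{2\xi(1-\eta)}{\xi^3+\xi^2-\xi-1}\right)^2\right]\left[x+\left(\frac{2\xi(1+\eta)}{\xi^3+\xi^2-\xi-1}\right)^2\right](x+1).$$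
   Context: The excluded points $\{(\xi,0):\xi^2+\xi-1=0\}$ are the points written in the paper as $(\frac{-1\pm\sqrt5}{2},0)$. Note $\xi^3+\xi^2-\xi-1=(\xi-1)(\xi+1)^2\neq0$ for admissible $\xi$. *)

(* Defs.v *)
From HB Require Import structures.
From mathcomp Require Import all_boot all_algebra.
From mathcomp Require Import ring.

Set Implicit Arguments.
Unset Strict Implicit.
Unset Printing Implicit Defensive.

Import GRing.Theory.
Local Open Scope ring_scope.

(* The cubic y^2 + a1 x y + a3 y = x^3 + a2 x^2 + a4 x + a6. *)
Record wcurve (K : fieldType) :=
  WCurve { a1 : K; a2 : K; a3 : K; a4 : K; a6 : K }.

Section Weierstrass.
Variables (K : fieldType) (E : wcurve K).

(* Standard discriminant in terms of b2, b4, b6, b8 (Silverman, AEC, III.1). *)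
Definition b2 : K := a1 E ^+ 2 + 4%:R * a2 E.
Definition b4 : K := 2%:R * a4 E + a1 E * a3 E.
Definition b6 : K := a3 E ^+ 2 + 4%:R * a6 E.
Definition b8 : K :=
  a1 E ^+ 2 * a6 E + 4%:R * a2 E * a6 E - a1 E * a3 E * a4 E
  + a2 E * a3 E ^+ 2 - a4 E ^+ 2.
Definition disc : K :=
  - b2 ^+ 2 * b8 - 8%:R * b4 ^+ 3 - 27%:R * b6 ^+ 2 + 9%:R * b2 * b4 * b6.

Definition elliptic : bool := disc != 0.

Definition weq (x y : K) : K :=
  y ^+ 2 + a1 E * x * y + a3 E * y
  - (x ^+ 3 + a2 E * x ^+ 2 + a4 E * x + a6 E).

(* [None] is the point at infinity. *)
Definition on_curve (p : option (K * K)) : bool :=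
  if p is Some (x, y) then weq x y == 0 else true.

Record point := Point { coords : option (K * K); coordsP : on_curve coords }.

HB.instance Definition _ := [isSub for coords].
HB.instance Definition _ := [Choice of point by <:].

Definition neg_coords (p : option (K * K)) : option (K * K) :=
  if p is Some (x, y) then Some (x, - y - a1 E * x - a3 E) else None.

(* Third intersection of the line of slope l through (x1, y1) with the cubic,
   reflected by [neg_coords]; x2 is the abscissa of the second point. *)
Definition line_coords (l x1 y1 x2 : K) : option (K * K) :=
  let x3 := l ^+ 2 + a1 E * l - a2 E - x1 - x2 in
  neg_coords (Some (x3, l * (x3 - x1) + y1)).

Definition add_coords (p q : option (K * K)) : option (K * K) :=
  match p, q with
  | None, _ => q
  | _, None => p
  | Some (x1, y1), Some (x2, y2) =>
      if x1 != x2 then line_coords ((y2 - y1) / (x2 - x1)) x1 y1 x2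
      else if y1 == - y2 - a1 E * x2 - a3 E then None
      else
        line_coords
          ((3%:R * x1 ^+ 2 + 2%:R * a2 E * x1 + a4 E - a1 E * y1)
             / (2%:R * y1 + a1 E * x1 + a3 E))
          x1 y1 x2
  end.

Lemma on_curve_neg p : on_curve p -> on_curve (neg_coords p).
Proof.
case: p => [[x y]|] //= /eqP h; apply/eqP; rewrite -[RHS]h /weq; ring.
Qed.

Lemma on_curve_add p q : on_curve p -> on_curve q -> on_curve (add_coords p q).
Proof.
case: p q => [[x1 y1]|] [[x2 y2]|] //.
move=> h1 h2; rewrite [add_coords _ _]/=.
move: h2; have [<-|ne] := eqVneq x1 x2 => h2; last first.
- have d : x2 - x1 != 0 by rewrite subr_eq0 eq_sym.
  apply: on_curve_neg; move: h1 h2 => /= /eqP h1 /eqP h2; apply/eqP.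
  set l := (y2 - y1) / (x2 - x1).
  have ey : y2 = y1 + l * (x2 - x1) by rewrite /l divfK // addrC subrK.
  set x3 := l ^+ 2 + _ - _ - _ - _.
  apply: (mulIf d); rewrite mul0r.
  transitivity ((x2 - x3) * weq x1 y1 + (x3 - x1) * weq x2 y2).
    by rewrite ey /weq /x3; ring.
  by rewrite h1 h2; ring.
case: ifP => // /negbT ne; apply: on_curve_neg.
move: h1 h2 => /= /eqP h1 /eqP h2; apply/eqP.
have ey : y2 = y1.
  have /eqP : (y1 - y2) * (y1 - (- y2 - a1 E * x1 - a3 E)) = 0.
    transitivity (weq x1 y1 - weq x1 y2); first by rewrite /weq; ring.
    by rewrite h1 h2 subrr.
  rewrite mulf_eq0 !subr_eq0 => /orP[/eqP <- //|/eqP e].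
  by rewrite e eqxx in ne.
rewrite {}ey {h2} in ne *.
have d : 2%:R * y1 + a1 E * x1 + a3 E != 0.
  apply: contraNneq ne => e; rewrite -subr_eq0; apply/eqP.
  by rewrite -[RHS]e; ring.
set N := 3%:R * x1 ^+ 2 + _ + _ - _.
set l := N / _; set x3 := l ^+ 2 + _ - _ - _ - _.
have el : l * (2%:R * y1 + a1 E * x1 + a3 E) = N by rewrite divfK.
transitivity
  (weq x1 y1 + (x3 - x1) * (l * (2%:R * y1 + a1 E * x1 + a3 E) - N)).
  by rewrite /weq /N /x3; ring.
by rewrite h1 el; ring.
Qed.

Definition ecO : point := @Point None isT.
Definition ec_neg (P : point) : point := Point (on_curve_neg (coordsP P)).
Definition ec_add (P Q : point) : point :=
  Point (on_curve_add (coordsP P) (coordsP Q)).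

Definition ec_subgroup (S : point -> Prop) : Prop :=
  [/\ S ecO, forall P Q, S P -> S Q -> S (ec_add P Q)
    & forall P, S P -> S (ec_neg P)].

(* f restricts to an isomorphism from the additive group G onto S. *)
Definition ec_group_iso (G : zmodType) (S : point -> Prop) (f : G -> point) :
    Prop :=
  [/\ injective f, forall P, S P <-> exists g, f g = P
    & forall g h, f (g + h) = ec_add (f g) (f h)].

Definition has_subgroup_isog (G : zmodType) : Prop :=
  exists S : point -> Prop,
    ec_subgroup S /\ exists f : G -> point, ec_group_iso S f.

End Weierstrass.

(* The curve obtained from E by the admissible change of variables
   x = u^2 x' + r, y = u^3 y' + u^2 s x' + t; see [weq_change_vars]. *)
Definition change_vars (K : fieldType) (E : wcurve K) (u r s t : K) :
    wcurve K :=
  {| a1 := (a1 E + 2%:R * s) / u;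
     a2 := (a2 E - s * a1 E + 3%:R * r - s ^+ 2) / u ^+ 2;
     a3 := (a3 E + r * a1 E + 2%:R * t) / u ^+ 3;
     a4 := (a4 E - s * a3 E + 2%:R * r * a2 E - (t + r * s) * a1 E
            + 3%:R * r ^+ 2 - 2%:R * s * t) / u ^+ 4;
     a6 := (a6 E + r * a4 E + r ^+ 2 * a2 E + r ^+ 3 - t * a3 E - t ^+ 2
            - r * t * a1 E) / u ^+ 6 |}.

Lemma weq_change_vars (K : fieldType) (E : wcurve K) (u r s t x y : K) :
  u != 0 ->
  weq E (u ^+ 2 * x + r) (u ^+ 3 * y + u ^+ 2 * s * x + t)
  = u ^+ 6 * weq (change_vars E u r s t) x y.
Proof. by move=> u0; rewrite /weq /=; field. Qed.

(* Isomorphism over K of Weierstrass curves with their points at infinity as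
   base points. *)
Definition wisomorphic (K : fieldType) (E E' : wcurve K) : Prop :=
  exists u r s t : K, u != 0 /\ E' = change_vars E u r s t.

(* The cubic y^2 = (x + c1) (x + c2) (x + c3). *)
Definition split_cubic (K : fieldType) (c1 c2 c3 : K) : wcurve K :=
  {| a1 := 0; a2 := c1 + c2 + c3; a3 := 0;
     a4 := c1 * c2 + c1 * c3 + c2 * c3; a6 := c1 * c2 * c3 |}.

Lemma weq_split_cubic (K : fieldType) (c1 c2 c3 x y : K) :
  weq (split_cubic c1 c2 c3) x y = y ^+ 2 - (x + c1) * (x + c2) * (x + c3).
Proof. by rewrite /weq /=; ring. Qed.

(* For some admissible (xi, eta) this cubic is singular (e.g. over F_11); being
   isomorphic to an elliptic curve rules those pairs out. *)
Definition curve5 (K : fieldType) (xi eta : K) : wcurve K :=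
  let d := xi ^+ 3 + xi ^+ 2 - xi - 1 in
  split_cubic ((2%:R * xi * (1 - eta) / d) ^+ 2)
              ((2%:R * xi * (1 + eta) / d) ^+ 2) 1.

Definition excluded5 (K : fieldType) (xi eta : K) : Prop :=
  (xi, eta) \in [:: (0, 0); (1, 1); (1, -1); (-1, 1); (-1, -1)]
  \/ (xi ^+ 2 + xi - 1 = 0 /\ eta = 0).

(* Main.v *)
(** From the torsion to the parameters: move E to y^2 = (x - e1) (x - e2) (x - e3)
    and let R have order 5, Q = 2R. Every x(Q) - ei is a square ri^2, where the ri
    are the roots of a cubic whose coefficients give x(R) - x(Q) = r1 r2 + r1 r3 +
    r2 r3 and y(Q) = r1 r2 r3. With s = (r1 + r2) / r3 and p = r1 r2 / r3^2, the
    condition 2Q = -R reads (p + s) ((p + s) (p - s)^2 - 4 p s) = 0 with p + s <> 0,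
    and xi = - p / s, eta = (r2 - r1) / (r1 + r2) parametrize this curve.

    Conversely, R and Q = 2R are explicit, and the group they generate, R -> Q ->
    -R -> -Q, is checked directly. Full associativity of the chord-tangent law is
    avoided: to adjoin the 2-torsion it is enough that P + (Q + T) = (P + Q) + T
    for T of order 2. *)
Require Import Defs.
From mathcomp Require Import all_boot all_algebra.
From mathcomp Require Import ring.

Set Implicit Arguments.
Unset Strict Implicit.
Unset Printing Implicit Defensive.

Import GRing.Theory.
Local Open Scope ring_scope.

(** * The part of the group law that needs no associativity *)

Lemma coords_inj (K : fieldType) (E : wcurve K) : injective (@coords K E).
Proof. exact: val_inj. Qed.

Section PointArithmetic.
Variables (K : fieldType) (E : wcurve K).

Lemma ec_addO (P : point E) : ec_add P (ecO E) = P.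
Proof. by apply: val_inj; case: P => [[[x y]|] h]. Qed.

Lemma ec_Oadd (P : point E) : ec_add (ecO E) P = P.
Proof. exact: val_inj. Qed.

Lemma ec_add_eqO (P Q : point E) : ec_add P Q = ecO E -> Q = ec_neg P.
Proof.
case: P Q => [[[x1 y1]|] hP] [[[x2 y2]|] hQ] /(congr1 val) /= h;
  apply: val_inj => //=.
move: h; have [<-|//] := eqVneq x1 x2; case: eqP => //= -> _.
by congr (Some (_, _)); ring.
Qed.

Lemma ec_addN (P : point E) : ec_add P (ec_neg P) = ecO E.
Proof.
apply: val_inj; case: P => [[[x y]|] hP] //=; rewrite eqxx /=.
by case: eqP => // -[]; ring.
Qed.

(** Without associativity nothing can be cancelled here. For an affine point the tangent formula
    returns the abscissa [x] only with ordinate [- y - a1 E * x - a3 E]; if that is [y], the sum was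
    [ecO] by definition. *)
Lemma ec_add_idem (P : point E) : ec_add P P = P -> P = ecO E.
Proof.
case: P => [[[x y]|] hP] /(congr1 val) /= h; apply: val_inj => //=.
move: h; rewrite eqxx /=; case: eqP => //= ne [ex].
by rewrite ex subrr mulr0 add0r => ey; case: ne; rewrite ey.
Qed.

Lemma weq_same_abscissa x y1 y2 :
  weq E x y1 = 0 -> weq E x y2 = 0 ->
  y1 = y2 \/ y1 = - y2 - a1 E * x - a3 E.
Proof.
move=> h1 h2.
have /eqP : (y1 - y2) * (y1 - (- y2 - a1 E * x - a3 E)) = 0.
  by transitivity (weq E x y1 - weq E x y2);
    [rewrite /weq; ring | rewrite h1 h2 subrr].
by rewrite mulf_eq0 !subr_eq0 => /orP[/eqP ->|/eqP ->]; [left|right].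
Qed.

Lemma ec_addC (P Q : point E) : ec_add P Q = ec_add Q P.
Proof.
case: P Q => [[[x1 y1]|] hP] [[[x2 y2]|] hQ]; apply: val_inj => //=.
have [ex|ne] := eqVneq x1 x2 => /=; last first.
  have d : x2 - x1 != 0 by rewrite subr_eq0 eq_sym.
  have d' : x1 - x2 != 0 by rewrite subr_eq0.
  by rewrite /line_coords /=; congr (Some (_, _)); field; rewrite ?d ?d'.
subst x2; move: hP hQ => /= /eqP hP /eqP hQ.
case: (weq_same_abscissa hP hQ) => -> //.
rewrite eqxx; case: eqP => // -[]; ring.
Qed.

(** An injective additive map is enough: [f 0] is idempotent, hence the point at infinity, and
    [f (- g)] is then forced to be the opposite of [f g], so the image is a subgroup. *)
Lemma has_subgroup_isogP (G : zmodType) :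
  has_subgroup_isog E G <->
  exists f : G -> point E,
    injective f /\ forall g h, f (g + h) = ec_add (f g) (f h).
Proof.
split=> [[S [_ [f [fI _ fD]]]]|[f [fI fD]]]; first by exists f.
have f0 : f 0 = ecO E by apply: ec_add_idem; rewrite -fD addr0.
exists (fun P => exists g, f g = P); split; last by exists f.
split=> [|_ _ [g <-] [h <-]|_ [g <-]]; first by exists 0.
  by exists (g + h); rewrite fD.
by exists (- g); apply: ec_add_eqO; rewrite -fD subrr.
Qed.

End PointArithmetic.

(** * Changes of variables respect the group law *)

Section ChangeOfVariables.
Variables (K : fieldType) (E : wcurve K) (u r s t : K).
Hypothesis u0 : u != 0.
Let E' := change_vars E u r s t.

Definition cv_coords (p : option (K * K)) : option (K * K) :=
  if p is Some (x, y)
  then Some (u ^+ 2 * x + r, u ^+ 3 * y + u ^+ 2 * s * x + t) else None.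

Lemma cv_on_curve p : on_curve E' p -> on_curve E (cv_coords p).
Proof.
case: p => [[x y]|] //= /eqP h; apply/eqP.
by rewrite weq_change_vars // h mulr0.
Qed.

Lemma cv_coords_inj : injective cv_coords.
Proof.
move=> [[x y]|] [[x' y']|] //= [] /addIr/(mulfI (expf_neq0 2 u0)) ->.
by move/addIr/addIr/(mulfI (expf_neq0 3 u0)) ->.
Qed.

(** The substitution is affine and keeps vertical lines vertical, so chords and tangents correspond;
    a line of slope [l] on [E'] becomes one of slope [u * l + s] on [E]. *)
Lemma cv_add p q : on_curve E' p -> on_curve E' q ->
  cv_coords (add_coords E' p q) = add_coords E (cv_coords p) (cv_coords q).
Proof.
case: p q => [[x1 y1]|] [[x2 y2]|] // hp hq.
rewrite [in RHS]/= [add_coords _ _ _]/=.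
rewrite (inj_eq (addIr r)) (inj_eq (mulfI (expf_neq0 2 u0))).
have [ex|ne] /= := eqVneq x1 x2; last first.
  have d : x2 - x1 != 0 by rewrite subr_eq0 eq_sym.
  have d' : u ^+ 2 * x2 + r - (u ^+ 2 * x1 + r) != 0.
    have -> : u ^+ 2 * x2 + r - (u ^+ 2 * x1 + r) = u ^+ 2 * (x2 - x1) by ring.
    by rewrite mulf_neq0 // expf_neq0.
  by rewrite /line_coords /=; congr (Some (_, _)); field; rewrite ?u0 ?d ?d'.
subst x2; set c := (X in _ = if X then _ else _).
have -> : (y1 == - y2 - (a1 E + 2 * s) / u * x1
                 - (a3 E + r * a1 E + 2 * t) / u ^+ 3) = c.
  rewrite /c -subr_eq0 -[RHS]subr_eq0 -(mulrI_eq0 _ (mulfI (expf_neq0 3 u0))).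
  by congr (_ == _); field.
case: ifP => // /negbT; rewrite {}/c => ne.
have ey : y1 = y2.
  move: hp hq => /= /eqP hp /eqP hq; case: (weq_same_abscissa hp hq) => // ey.
  by case/eqP: ne; rewrite ey /=; field.
subst y2; set D := 2 * (u ^+ 3 * y1 + u ^+ 2 * s * x1 + t)
  + a1 E * (u ^+ 2 * x1 + r) + a3 E.
have d : D != 0.
  apply: contraNneq ne => e; rewrite -subr_eq0 -e; apply/eqP.
  by rewrite /D; ring.
(* [N / D] is the tangent slope on [E]; the two rewrites below show that the slope on [E'] is
   [(N / D - s) / u]. *)
have -> : 2 * y1 + (a1 E + 2 * s) / u * x1 + (a3 E + r * a1 E + 2 * t) / u ^+ 3
  = D / u ^+ 3 by rewrite /D; field.
set N := 3 * (u ^+ 2 * x1 + r) ^+ 2 + _ + _ - _.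
have -> : 3 * x1 ^+ 2
   + 2 * ((a2 E - s * a1 E + 3 * r - s ^+ 2) / u ^+ 2) * x1 +
   (a4 E - s * a3 E + 2 * r * a2 E - (t + r * s) * a1 E + 3 * r ^+ 2
      - 2 * s * t) / u ^+ 4 - (a1 E + 2 * s) / u * y1
  = (N - s * D) / u ^+ 4 by rewrite /N /D; field.
by rewrite /line_coords /=; congr (Some (_, _)); field; rewrite d u0.
Qed.

Definition cv_point (P : point E') : point E := Point (cv_on_curve (coordsP P)).

Lemma cv_has_subgroup (G : zmodType) :
  has_subgroup_isog E' G -> has_subgroup_isog E G.
Proof.
case/has_subgroup_isogP=> f [fI fD]; apply/has_subgroup_isogP.
exists (cv_point \o f); split=> [g h /(congr1 val)/= /cv_coords_inj e|g h].
  exact/fI/val_inj.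
by apply: val_inj; rewrite /= fD /= cv_add //; apply: coordsP.
Qed.

Lemma disc_change_vars : disc E' = disc E / u ^+ 12.
Proof. by rewrite /disc /b2 /b4 /b6 /b8 /=; field. Qed.

End ChangeOfVariables.

Lemma wcurve_ext (K : fieldType) (E E' : wcurve K) :
  a1 E = a1 E' -> a2 E = a2 E' -> a3 E = a3 E' -> a4 E = a4 E' ->
  a6 E = a6 E' -> E = E'.
Proof. by case: E E' => [? ? ? ? ?] [? ? ? ? ?] /= -> -> -> -> ->. Qed.

Lemma wisomorphic_sym (K : fieldType) (E E' : wcurve K) :
  wisomorphic E E' -> wisomorphic E' E.
Proof.
case=> u [r [s [t [u0 ->]]]].
(* Obtained by solving x = u^2 x' + r, y = u^3 y' + u^2 s x' + t for x' and y'. *)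
exists u^-1, (- r / u ^+ 2), (- s / u), ((s * r - t) / u ^+ 3).
by split; rewrite ?invr_eq0 //; apply: wcurve_ext => /=; field; rewrite ?oner_neq0 u0.
Qed.

Lemma wisomorphic_trans (K : fieldType) (E1 E2 E3 : wcurve K) :
  wisomorphic E1 E2 -> wisomorphic E2 E3 -> wisomorphic E1 E3.
Proof.
case=> u [r [s [t [u0 ->]]]] [u' [r' [s' [t' [u0' ->]]]]].
exists (u * u'), (u ^+ 2 * r' + r), (u * s' + s),
  (u ^+ 3 * t' + u ^+ 2 * s * r' + t).
split; first by rewrite mulf_neq0.
by apply: wcurve_ext => /=; field; rewrite ?u0 ?u0'.
Qed.

Lemma wisomorphic_has_subgroup (K : fieldType) (E E' : wcurve K) (G : zmodType) :
  wisomorphic E E' -> has_subgroup_isog E' G -> has_subgroup_isog E G.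
Proof. by case=> u [r [s [t [u0 ->]]]]; apply: cv_has_subgroup. Qed.

(** * Chords and tangents on y^2 = x^3 + a x^2 + b x + c *)

Section ShortModel.
Variables (K : fieldType) (a b c : K).
Let E := WCurve 0 a 0 b c.

Lemma weq_short x y : weq E x y = y ^+ 2 - (x ^+ 3 + a * x ^+ 2 + b * x + c).
Proof. by rewrite /weq /=; ring. Qed.

(** The slope is characterized by a product instead of a quotient, so that each use can supply it in
    simplified form. *)
Lemma add_secant (l x1 y1 x2 y2 x3 y3 : K) :
  x1 != x2 -> l * (x2 - x1) = y2 - y1 ->
  x3 = l ^+ 2 - a - x1 - x2 -> y3 = l * (x1 - x3) - y1 ->
  add_coords E (Some (x1, y1)) (Some (x2, y2)) = Some (x3, y3).
Proof.
move=> ne hl -> ->; rewrite /= ne -hl mulfK ?subr_eq0 1?eq_sym //.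
rewrite /line_coords /=. congr (Some (_, _)); ring.
Qed.

Lemma add_tangent (l x1 y1 x3 y3 : K) :
  2 * y1 != 0 -> l * (2 * y1) = 3 * x1 ^+ 2 + 2 * a * x1 + b ->
  x3 = l ^+ 2 - a - x1 - x1 -> y3 = l * (x1 - x3) - y1 ->
  add_coords E (Some (x1, y1)) (Some (x1, y1)) = Some (x3, y3).
Proof.
move=> ne hl -> ->; rewrite /= eqxx /= !mul0r !addr0 !subr0 -hl mulfK //.
case: eqP => [e|_]; last first.
  by rewrite /line_coords /=; congr (Some (_, _)); ring.
by case/eqP: ne; rewrite mulrDl mul1r {1}e addNr.
Qed.

Lemma add_opposite x y : add_coords E (Some (x, y)) (Some (x, - y)) = None.
Proof. by rewrite /= eqxx mul0r !subr0 opprK eqxx. Qed.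

End ShortModel.

(** * Associativity when the last summand has order 2 *)

Definition associates (K : fieldType) (E : wcurve K) (Z : point E) :=
  forall P Q, ec_add P (ec_add Q Z) = ec_add (ec_add P Q) Z.

(* On y^2 = x (x^2 + a x + b), a point with x != 0 is written (x, m x). Then
   a and b are rational functions of x and m (for two points, of x1, m1, x2
   and m2), which leaves identities between rational functions. *)
Section TwoTorsionAtOrigin.
Variables (K : fieldType) (a b : K).
Hypothesis two0 : (2 : K) != 0.
Hypotheses (b0 : b != 0) (ab0 : a ^+ 2 - 4 * b != 0).
Let E := WCurve 0 a 0 b 0.
Let T : option (K * K) := Some (0, 0).

(** The line of slope [m] through the origin meets the cubic again at the roots of X^2 + (a - m^2) X
    + b. Hence translation by [T] sends the abscissa x to b / x. *)
Lemma add_origin x m : x != 0 -> b = x * (m ^+ 2 - x - a) ->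
  add_coords E (Some (x, m * x)) T
  = Some (m ^+ 2 - x - a, - (m ^+ 2 - x - a) * m).
Proof. by move=> x0 hb; apply: (@add_secant _ _ _ _ m) => //; ring. Qed.

Lemma slope_coord x y : x != 0 -> weq E x y = 0 ->
  exists m, y = m * x /\ b = x * (m ^+ 2 - x - a).
Proof.
move=> x0 h; have ey : y = y / x * x by rewrite divfK.
exists (y / x); split=> //; move: h; rewrite weq_short ey.
set m := y / x => h; apply: (mulfI x0); apply/eqP.
by rewrite -subr_eq0 -oppr_eq0 -h mulfK //; apply/eqP; ring.
Qed.

Lemma add_origin_same_abscissa x y1 y2 :
  x != 0 -> weq E x y1 = 0 -> weq E x y2 = 0 ->
  add_coords E (Some (x, y1)) (add_coords E (Some (x, y2)) T)
  = add_coords E (add_coords E (Some (x, y1)) (Some (x, y2))) T.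
Proof.
move=> x0 h1 h2; have [m [ey eb]] := slope_coord x0 h1.
set k := m ^+ 2 - x - a in eb.
have ea : a = m ^+ 2 - x - k by rewrite /k; ring.
have k0 : k != 0 by apply: contraNneq b0 => k0; rewrite eb k0 mulr0.
(* Here [k] is b / x, the abscissa after translation by [T]. If x = k and m = 0, then a = - 2 x and
   b = x^2, and the cubic is singular. *)
have m0 : x = k -> m != 0.
  move=> xk; apply: contraNneq ab0 => m0.
  by apply/eqP; rewrite eb ea m0 -xk; ring.
(* When x = k, the line joining the point to the origin is tangent at the point, which is therefore
   a half of [T]. *)
have double : x = k -> add_coords E (Some (x, y1)) (Some (x, y1)) = T.
  move=> xk; rewrite ey; apply: (@add_tangent _ _ _ _ m).
  - by rewrite !mulf_neq0 ?m0.
  - by rewrite eb ea -xk; ring.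
  - by rewrite ea -xk; ring.
  - ring.
have same : add_coords E (Some (x, y1)) (add_coords E (Some (x, - y1)) T) = T.
  have -> : - y1 = - m * x by rewrite ey; ring.
  have eb' : b = x * ((- m) ^+ 2 - x - a) by rewrite sqrrN.
  rewrite add_origin // sqrrN mulrNN -/k.
  have [xk|xk] := eqVneq x k.
    by rewrite [k * m]mulrC -xk -ey double.
  rewrite ey; apply: (@add_secant _ _ _ _ m) => //; first by ring.
    by rewrite ea; ring.
  ring.
have [y0|y0] := eqVneq y1 0.
  have -> : y2 = - y1.
    case: (weq_same_abscissa h1 h2) => e; last by rewrite e /=; ring.
    by rewrite -e y0 oppr0.
  by rewrite same add_opposite.
case: (weq_same_abscissa h2 h1) => ->; last first.
  have -> : - y1 - a1 E * x - a3 E = - y1 by rewrite /= mul0r !subr0.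
  by rewrite same add_opposite.
have m1 : m != 0 by apply: contraNneq y0 => m1; rewrite ey m1 mul0r.
rewrite ey add_origin // -/k mulNr [k * m]mulrC.
have [xk|xk] := eqVneq x k.
  by rewrite -xk add_opposite -ey double // /= eqxx mul0r !subr0 oppr0 eqxx.
have kx : k - x != 0 by rewrite subr_eq0 eq_sym.
have d : add_coords E (Some (x, m * x)) (Some (x, m * x)) =
  Some (((x - k) / (2 * m)) ^+ 2,
    (m ^+ 2 * 2 + x - k) / (2 * m) * (x - ((x - k) / (2 * m)) ^+ 2) - m * x).
  apply: (@add_tangent _ _ _ _ ((m ^+ 2 * 2 + x - k) / (2 * m))) => //.
  - by rewrite !mulf_neq0.
  - by rewrite eb ea; field; rewrite ?two0 ?m1.
  - by rewrite ea; field; rewrite ?two0 ?m1.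
(* [n] is the ordinate of the double divided by its abscissa, the form that [add_origin] expects. *)
set n := (m ^+ 2 * 2 + x - k) / (2 * m) * (x * (2 * m) ^+ 2 - (x - k) ^+ 2)
  / (x - k) ^+ 2 - m * x * (2 * m) ^+ 2 / (x - k) ^+ 2.
have xk' : x - k != 0 by rewrite subr_eq0.
rewrite d.
have -> : (m ^+ 2 * 2 + x - k) / (2 * m) * (x - ((x - k) / (2 * m)) ^+ 2) - m * x
  = n * ((x - k) / (2 * m)) ^+ 2.
  by rewrite /n; field; rewrite ?kx ?xk' ?two0 ?m1.
rewrite add_origin.
- apply: (@add_secant _ _ _ _ (- m * (x + k) / (k - x))) => //.
  + by rewrite /n; field.
  + by rewrite /n ea; field; rewrite ?kx ?xk' ?two0 ?m1.
  + by rewrite /n ea; field; rewrite ?kx ?xk' ?two0 ?m1.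
- by rewrite expf_neq0 // mulf_neq0 // invr_eq0 mulf_neq0.
- by rewrite eb /n ea; field; rewrite ?kx ?xk' ?two0 ?m1.
Qed.

Lemma add_origin_generic x1 y1 x2 y2 :
  x1 != x2 -> x1 != 0 -> x2 != 0 -> weq E x1 y1 = 0 -> weq E x2 y2 = 0 ->
  add_coords E (Some (x1, y1)) (add_coords E (Some (x2, y2)) T)
  = add_coords E (add_coords E (Some (x1, y1)) (Some (x2, y2))) T.
Proof.
move=> ne x10 x20 h1 h2; have [m1 [ey1 eb1]] := slope_coord x10 h1.
have [m2 [ey2 eb2]] := slope_coord x20 h2.
have d : x2 - x1 != 0 by rewrite subr_eq0 eq_sym.
have d' : x1 - x2 != 0 by rewrite subr_eq0.
(* Eliminating [a] between [eb1] and [eb2] gives b = x1 x2 c; the translate of the second point by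
   [T] then has abscissa x1 c. *)
set c := 1 + (m2 ^+ 2 - m1 ^+ 2) / (x1 - x2).
have ea : a = (m1 ^+ 2 * x1 - m2 ^+ 2 * x2) / (x1 - x2) - x1 - x2.
  have e : x2 * (m2 ^+ 2 - x2 - a) - x1 * (m1 ^+ 2 - x1 - a) = 0.
    by rewrite -eb1 -eb2 subrr.
  have ha : a * (x1 - x2)
      = m1 ^+ 2 * x1 - m2 ^+ 2 * x2 - (x1 + x2) * (x1 - x2).
    by rewrite -[LHS]subr0 -e; ring.
  by apply: (mulIf d'); rewrite ha; field.
have eb : b = x1 * x2 * c by rewrite eb1 ea /c; field.
have c0 : c != 0 by apply: contraNneq b0 => c0; rewrite eb c0 mulr0.
have -> : add_coords E (Some (x2, y2)) T = Some (x1 * c, - (x1 * c) * m2).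
  rewrite ey2 add_origin //.
  by have -> : m2 ^+ 2 - x2 - a = x1 * c by rewrite ea /c; field.
set l := (m2 * x2 - m1 * x1) / (x2 - x1).
set x3 := x1 * x2 * ((m1 - m2) / (x1 - x2)) ^+ 2.
have -> : add_coords E (Some (x1, y1)) (Some (x2, y2))
    = Some (x3, l * (x1 - x3) - m1 * x1).
  rewrite ey1 ey2; apply: (@add_secant _ _ _ _ l) => //; first by rewrite divfK.
  by rewrite ea /x3 /l; field; rewrite d d'.
(* With equal slopes the two points are collinear with the origin, so their sum is [T] and both
   sides are at infinity. *)
have [em|nm] := eqVneq m1 m2.
  have ec : c = 1 by rewrite /c em subrr mul0r addr0.
  have ex3 : x3 = 0 by rewrite /x3 em subrr mul0r expr0n mulr0.
  rewrite ex3 subr0 /l em -mulrBr mulfK // subrr ec mulr1.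
  by rewrite ey1 em mulNr mulrC add_opposite /= eqxx mul0r !subr0 oppr0 eqxx.
have nm0 : m1 - m2 != 0 by rewrite subr_eq0.
have x30 : x3 != 0 by rewrite !mulf_neq0 ?invr_eq0.
set m3 := (l * (x1 - x3) - m1 * x1) / x3.
have -> : l * (x1 - x3) - m1 * x1 = m3 * x3 by rewrite divfK.
have eb3 : b = x3 * (m3 ^+ 2 - x3 - a).
  by rewrite eb ea /c /m3 /l /x3; field; rewrite x10 x20 d d' nm0.
rewrite add_origin //.
(* With opposite slopes, translation by [T] takes the second point to the first, and the left-hand
   side is a doubling. Otherwise c <> 1 and it is a chord. *)
have [em|nm'] := eqVneq (m1 + m2) 0.
  have em2 : m2 = - m1 by apply/eqP; rewrite -addr_eq0 addrC em.
  have m10 : m1 != 0.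
    by apply: contraNneq nm0 => e; rewrite em2 e oppr0 subrr.
  have ec : c = 1 by rewrite /c em2 sqrrN subrr mul0r addr0.
  have two_m1 : m1 - - m1 != 0.
    by rewrite opprK -mulr2n -mulr_natl mulf_neq0.
  have -> : - (x1 * c) * m2 = y1 by rewrite ec em2 ey1; ring.
  rewrite ec mulr1 ey1.
  apply: (@add_tangent _ _ _ _ ((x1 - x2 + 2 * m1 ^+ 2) / (2 * m1))).
  - by rewrite !mulf_neq0.
  - by rewrite eb ec ea em2; field; rewrite d' two0 m10.
  - by rewrite /m3 /l /x3 ea em2; field; rewrite ?x10 ?x20 ?d ?d' ?two0 ?m10 ?two_m1.
  - by rewrite /m3 /l /x3 ea em2; field; rewrite ?x10 ?x20 ?d ?d' ?two0 ?m10 ?two_m1.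
have dm : m2 ^+ 2 - m1 ^+ 2 != 0.
  by rewrite subr_sqr mulf_neq0 // [X in X != 0]addrC // addrC subr_eq0 eq_sym.
have c1 : c - 1 != 0 by rewrite /c addrC addKr mulf_neq0 ?invr_eq0.
have c1' : x1 - x2 + (m2 ^+ 2 - m1 ^+ 2) + -1 * (x1 - x2) != 0.
  by rewrite mulN1r addrAC subrr add0r.
have c2 : x1 * c - x1 != 0 by rewrite -[X in _ - X]mulr1 -mulrBr mulf_neq0.
rewrite ey1; apply: (@add_secant _ _ _ _ (- (c * m2 + m1) / (c - 1))).
- by rewrite eq_sym -subr_eq0.
- by field.
- by rewrite /m3 /l /x3 ea /c; field; rewrite ?x10 ?x20 ?d ?d' ?nm0 ?c1'.
- by rewrite /m3 /l /x3 ea /c; field; rewrite ?x10 ?x20 ?d ?d' ?nm0 ?c1'.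
Qed.

End TwoTorsionAtOrigin.

(** Beyond the two preceding lemmas, the case P = Z follows from commutativity and the case Q = Z
    from the fact that translation by [Z] is an involution ([inv]). *)
Lemma origin_associates (K : fieldType) (a b : K) (E : wcurve K) (Z : point E) :
  (2 : K) != 0 -> b != 0 -> a ^+ 2 - 4 * b != 0 -> E = WCurve 0 a 0 b 0 ->
  coords Z = Some (0, 0) -> associates Z.
Proof.
move=> two0 b0 ab0 eE; subst E => hZ.
pose W := WCurve 0 a 0 b 0.
have ZZ : ec_add Z Z = ecO _.
  by apply: val_inj; rewrite /= hZ /= eqxx mul0r !subr0 oppr0 eqxx.
have eqZ (x y : K) h : x = 0 -> @Point _ (WCurve 0 a 0 b 0) (Some (x, y)) h = Z.
  move=> x0; subst x; apply: val_inj; rewrite /= hZ.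
  move: h => /= /eqP; rewrite weq_short !expr0n !mulr0 !addr0 subr0 => /eqP.
  by rewrite expf_eq0 /= => /eqP ->.
have inv P : ec_add (ec_add P Z) Z = P.
  case: P => [[[x y]|] h]; last first.
    by rewrite [X in ec_add X _](_ : _ = Z) ?ZZ; apply: val_inj.
  have [x0|x0] := eqVneq x 0; first by rewrite (eqZ _ _ _ x0) ZZ ec_Oadd.
  have [m [ey eb]] := slope_coord x0 (eqP h).
  have k0 : m ^+ 2 - x - a != 0.
    by apply: contraNneq b0 => k0; rewrite eb k0 mulr0.
  apply: val_inj.
  transitivity (add_coords W (add_coords W (Some (x, y)) (coords Z)) (coords Z)).
    by [].
  rewrite [RHS]/= hZ ey -/W add_origin // mulNr -mulrN mulrC.
  have eb' : b = (m ^+ 2 - x - a) * ((- m) ^+ 2 - (m ^+ 2 - x - a) - a).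
    by rewrite {1}eb; ring.
  by rewrite add_origin //; congr (Some (_, _)); ring.
have coords_assocl P Q : val (ec_add P (ec_add Q Z)) =
  add_coords W (coords P) (add_coords W (coords Q) (coords Z)) by [].
have coords_assocr P Q : val (ec_add (ec_add P Q) Z) =
  add_coords W (add_coords W (coords P) (coords Q)) (coords Z) by [].
move=> P Q; case: (P) (Q) => [[[x1 y1]|] h1] [[[x2 y2]|] h2].
- have [x10|x10] := eqVneq x1 0.
    by rewrite (eqZ _ _ _ x10) ![ec_add Z _]ec_addC.
  have [x20|x20] := eqVneq x2 0.
    by rewrite (eqZ _ _ _ x20) ZZ ec_addO inv.
  have [ex|ne] := eqVneq x1 x2.
    subst x2; apply: val_inj; rewrite [LHS]coords_assocl [RHS]coords_assocr hZ.
    exact: (add_origin_same_abscissa two0 b0 ab0 x10 (eqP h1) (eqP h2)).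
  apply: val_inj; rewrite [LHS]coords_assocl [RHS]coords_assocr hZ.
  exact: (add_origin_generic two0 b0 ne x10 x20 (eqP h1) (eqP h2)).
- have -> : Point h2 = ecO _ by apply: val_inj.
  by rewrite ec_Oadd ec_addO.
- have -> : Point h1 = ecO _ by apply: val_inj.
  by rewrite !ec_Oadd.
- have -> : Point h1 = ecO _ by apply: val_inj.
  by rewrite !ec_Oadd.
Qed.

(** * From the origin to an arbitrary point of order 2 *)

Section ChangeOfVariablesAssociates.
Variables (K : fieldType) (E : wcurve K) (u r s t : K).
Hypothesis u0 : u != 0.
Let E' := change_vars E u r s t.

(** Needed because [associates] quantifies over all points of the target curve. *)
Lemma cv_point_surj (P : point E) : exists P' : point E', P = cv_point u0 P'.
Proof.
case: P => [[[x y]|] h]; last by exists (ecO E'); apply: val_inj.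
set x' := (x - r) / u ^+ 2; set y' := (y - s * (x - r) - t) / u ^+ 3.
have ex : u ^+ 2 * x' + r = x by rewrite /x'; field.
have ey : u ^+ 3 * y' + u ^+ 2 * s * x' + t = y by rewrite /x' /y'; field.
have h' : on_curve E' (Some (x', y')).
  apply/eqP/(mulfI (expf_neq0 6 u0)); rewrite -weq_change_vars //.
  by rewrite ex ey mulr0; apply/eqP.
by exists (Point h'); apply: val_inj; rewrite /= ex ey.
Qed.

Lemma cv_pointD (P Q : point E') :
  cv_point u0 (ec_add P Q) = ec_add (cv_point u0 P) (cv_point u0 Q).
Proof. by apply: val_inj; rewrite /= cv_add //; apply: coordsP. Qed.

Lemma cv_associates (Z : point E') : associates Z -> associates (cv_point u0 Z).
Proof.
move=> hZ P Q; have [[P' ->] [Q' ->]] := (cv_point_surj P, cv_point_surj Q).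
by rewrite -!cv_pointD hZ.
Qed.

End ChangeOfVariablesAssociates.

(* The inversion is the automorphism given by u = -1. *)
Lemma ec_negD (K : fieldType) (E : wcurve K) (P Q : point E) :
  ec_neg (ec_add P Q) = ec_add (ec_neg P) (ec_neg Q).
Proof.
have n0 : (-1 : K) != 0 by rewrite oppr_eq0 oner_eq0.
have eE : change_vars E (-1) 0 (- a1 E) (- a3 E) = E.
  by apply: wcurve_ext => /=; field; rewrite ?n0 ?oner_eq0.
have neg p : neg_coords E p = cv_coords (-1) 0 (- a1 E) (- a3 E) p.
  by case: p => [[x y]|] //=; congr (Some (_, _)); ring.
apply: val_inj; rewrite /= !neg -cv_add ?eE //; exact: coordsP.
Qed.

Lemma ec_negK (K : fieldType) (E : wcurve K) : involutive (@ec_neg K E).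
Proof.
move=> [[[x y]|] h]; apply: val_inj => //=.
by congr (Some (_, _)); ring.
Qed.

Section SplitCubic.
Variable K : fieldType.
Hypothesis two0 : (2 : K) != 0.

Lemma disc_split_cubic (c1 c2 c3 : K) : disc (split_cubic c1 c2 c3)
  = 16 * ((c1 - c2) * (c1 - c3) * (c2 - c3)) ^+ 2.
Proof. by rewrite /disc /b2 /b4 /b6 /b8 /=; ring. Qed.

Lemma split_cubic_associates (E : wcurve K) (c1 c2 c3 : K) (Z : point E) :
  E = split_cubic c1 c2 c3 -> elliptic E -> coords Z = Some (- c1, 0) ->
  associates Z.
Proof.
move=> eE; subst E; rewrite /elliptic disc_split_cubic mulf_eq0 expf_eq0 /=.
rewrite !mulf_eq0 !negb_or => /andP[_ /andP[/andP[d12 d13] d23]] hZ.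
have u0 : (1 : K) != 0 := oner_neq0 _.
(* Translating [Z] to the origin turns the cubic into x (x + c2 - c1) (x + c3 - c1). *)
have [Z' eZ] := cv_point_surj (- c1) 0 0 u0 Z; rewrite eZ.
apply: cv_associates.
apply: (@origin_associates _ (c2 - c1 + (c3 - c1)) ((c2 - c1) * (c3 - c1))) => //.
- by rewrite mulf_neq0 // -oppr_eq0 opprB.
- have -> : (c2 - c1 + (c3 - c1)) ^+ 2 - 4 * ((c2 - c1) * (c3 - c1))
    = (c2 - c3) ^+ 2 by ring.
  by rewrite expf_neq0.
- by apply: wcurve_ext => /=; field; rewrite ?u0.
- move: hZ; rewrite eZ /=; case: (coords Z') => [[x y]|] //= [].
  rewrite !expr1n !mul1r mul0r !addr0 => ex ->; congr (Some (_, _)).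
  by move/(canRL (addrK _)): ex => ->; rewrite subrr.
Qed.

End SplitCubic.

(** * Assembling Z/10 + Z/2 from 5-torsion and two points of order 2 *)

Section TenTwo.
Variables (K : fieldType) (E : wcurve K) (A : nat -> point E).
Hypothesis AD : forall i j, A (i + j) = ec_add (A i) (A j).
Hypothesis A0 : forall i, (A i = ecO E) <-> (5 %| i)%N.
Variables T1 T2 : point E.
Hypotheses (assoc1 : associates T1) (assoc2 : associates T2).
Hypotheses (T1T1 : ec_add T1 T1 = ecO E) (T2T2 : ec_add T2 T2 = ecO E).
Hypotheses (T10 : T1 <> ecO E) (T20 : T2 <> ecO E) (T12 : T1 <> T2).

Let B (b : bool) := if b then T1 else ecO E.
Let C (b : bool) := if b then T2 else ecO E.

Let assocB b : associates (B b).
Proof. by case: b => // P Q; rewrite !ec_addO. Qed.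

Let assocC b : associates (C b).
Proof. by case: b => // P Q; rewrite !ec_addO. Qed.

Let BD b b' : B (b (+) b') = ec_add (B b) (B b').
Proof. by case: b b' => [] []; rewrite /= ?T1T1 ?ec_addO ?ec_Oadd. Qed.

Let CD b b' : C (b (+) b') = ec_add (C b) (C b').
Proof. by case: b b' => [] []; rewrite /= ?T2T2 ?ec_addO ?ec_Oadd. Qed.

(** Z/10 is treated as Z/5 + Z/2: its element m contributes [A m], of period 5, and its parity. *)
Let f (g : 'Z_10 * 'Z_2) :=
  ec_add (ec_add (A g.1) (B (odd g.1))) (C (odd g.2)).

Let fD g h : f (g + h) = ec_add (f g) (f h).
Proof.
case: g h => [m n] [m' n']; rewrite /f /=.
have -> : A ((m + m') %% 10)%N = ec_add (A m') (A m).
  rewrite ec_addC -AD [in RHS](divn_eq (m + m') 10) AD.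
  by rewrite (iffRL (A0 ((m + m') %/ 10 * 10)%N)) ?ec_Oadd // dvdn_mull.
rewrite !odd_mod // !oddD BD CD.
(* Only the terms [B] and [C] associate, and only in last position; the terms in [A] are brought
   together first, through commutativity. *)
set y := ec_add (A m') (A m); set x := ec_add (ec_add (A m) _) _.
have ex : ec_add x (A m') = ec_add (ec_add y (B (odd m))) (C (odd n)).
  by rewrite ec_addC assocC assocB.
rewrite [RHS]assocC [LHS]assocC; congr (ec_add _ _).
rewrite [RHS]assocB ex -[RHS]assocB [ec_add (C _) _]ec_addC [RHS]assocC.
by rewrite [in LHS]assocB.
Qed.

(** For an element of the kernel, [A m] is a sum of points killed by 2, so A (2 m) vanishes and 5
    divides m. What remains is an equality between the [B] and [C] terms; as [T1], [T2] and [ecO E]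
    are distinct, both parities are even. *)
Lemma ten_two_subgroup : has_subgroup_isog E ('Z_10 * 'Z_2)%type.
Proof.
apply/has_subgroup_isogP; exists f; split=> // g h efg.
have f0 : f 0 = ecO E by apply: ec_add_idem; rewrite -fD addr0.
have : f (g - h) = ecO E by rewrite fD efg -fD subrr f0.
move=> fgh; apply/eqP; rewrite -subr_eq0; apply/eqP.
case: (g - h) fgh => m n; rewrite /f /= => fmn.
have CC b : ec_add (C b) (C b) = ecO E by rewrite -CD addbb.
have BB b : ec_add (B b) (B b) = ecO E by rewrite -BD addbb.
have e1 : ec_add (A m) (B (odd m)) = C (odd n).
  by rewrite -[LHS]ec_addO -(CC (odd n)) assocC fmn ec_Oadd.
have e2 : A m = ec_add (C (odd n)) (B (odd m)).
  by rewrite -e1 -assocB BB ec_addO.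
have e3 : A (m + m) = ecO E.
  rewrite AD e2 assocB [ec_add (ec_add _ _) (C _)]ec_addC assocB CC ec_Oadd.
  exact: BB.
have m5 : (5 %| m)%N.
  by move/A0: e3; rewrite addnn -muln2 mulnC Gauss_dvdr.
have e4 : C (odd n) = B (odd m).
  by rewrite -[RHS]ec_Oadd -[ecO E](iffRL (A0 m) m5) e1.
have [om on] : odd m = false /\ odd n = false.
  by move: e4; case: (odd m) (odd n) => [] [] //= /esym.
have m0 : m = 0.
  by apply/val_inj; move: m5 om; rewrite /=; case: (m) => -[|[|[|[|[|[|[|[|[|[|//]]]]]]]]]].
have n0 : n = 0 by apply/val_inj; move: on; case: (n) => -[|[|//]].
by rewrite m0 n0.
Qed.
End TenTwo.

(** * The cyclic subgroup of order 5 *)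

Lemma cyclic5 (K : fieldType) (E : wcurve K) (R Q : point E) :
  ec_add R R = Q -> ec_add Q Q = ec_neg R -> ec_add R Q = ec_neg Q ->
  ec_add R (ec_neg Q) = ec_neg R -> R <> ecO E -> Q <> ecO E ->
  exists A : nat -> point E,
    (forall i j, A (i + j) = ec_add (A i) (A j)) /\
    (forall i, A i = ecO E <-> (5 %| i)%N).
Proof.
move=> RR QQ RQ RNQ R0 Q0.
have QNR : ec_add Q (ec_neg R) = R.
  by rewrite -[RHS]ec_negK -[in RHS]RNQ ec_negD ec_negK ec_addC.
have NRNR : ec_add (ec_neg R) (ec_neg R) = ec_neg Q by rewrite -ec_negD RR.
have NQNQ : ec_add (ec_neg Q) (ec_neg Q) = R by rewrite -ec_negD QQ ec_negK.
have NRNQ : ec_add (ec_neg R) (ec_neg Q) = Q by rewrite -ec_negD RQ ec_negK.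
have neg0 P : ec_neg P = ecO E -> P = ecO E.
  by move=> e; rewrite -[P]ec_negK e; apply: val_inj.
(* The table lists the multiples of [R], with 3R = - Q and 4R = - R. Additivity becomes a check of
   25 sums. *)
exists (fun i => nth (ecO E) [:: ecO E; R; Q; ec_neg Q; ec_neg R] (i %% 5)).
split=> [i j|i]; last first.
  rewrite /dvdn; have : (i %% 5 < 5)%N by rewrite ltn_mod.
  by case: (i %% 5)%N => [|[|[|[|[|//]]]]] _ /=; split=> //;
    first [move/R0 | move/Q0 | move/neg0/Q0 | move/neg0/R0].
rewrite -modnDm; have : (i %% 5 < 5)%N by rewrite ltn_mod.
have : (j %% 5 < 5)%N by rewrite ltn_mod.
case: (j %% 5)%N => [|[|[|[|[|//]]]]] _; case: (i %% 5)%N => [|[|[|[|[|//]]]]] _;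
  rewrite /= ?ec_addO ?ec_Oadd // ?ec_addN //;
  by [rewrite RR | rewrite QQ | rewrite RQ | rewrite ec_addC RQ
     | rewrite RNQ | rewrite ec_addC RNQ | rewrite QNR | rewrite ec_addC QNR
     | rewrite NRNR | rewrite NQNQ | rewrite NRNQ | rewrite ec_addC NRNQ
     | rewrite ec_addC ec_addN].
Qed.

Section FiveTorsion.
Variables (K : fieldType) (xi : K).
Hypothesis two0 : (2 : K) != 0.
Hypotheses (xi0 : xi != 0) (xi1 : xi - 1 != 0) (xi2 : xi + 1 != 0).
(* s = alpha + beta and p = alpha beta, where alpha^2, beta^2 and 1 are the
   constants of the split cubic. *)
Let s := 4 * xi / ((xi - 1) * (xi + 1) ^+ 2).
Let p := - xi * s.
Let E := WCurve 0 (s ^+ 2 - 2 * p + 1) 0 (p ^+ 2 + s ^+ 2 - 2 * p) (p ^+ 2).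
Hypothesis ps0 : p + s + 1 != 0.
(** Taking x(Q) = 0 and the square roots alpha, beta, 1 gives x(R) = alpha beta + alpha + beta and
    y(Q) = alpha beta. The tangent at R has slope alpha + beta + 1 = s + 1, which determines y(R);
    [l] below is the tangent slope at Q. *)
Let Rc := Some (p + s, s * (p + s + 1)).
Let Qc : option (K * K) := Some (0, p).
Let l := - (xi ^+ 2 * s + s + 2 * xi) / (2 * xi).

Let s0 : s != 0.
Proof.
have -> : s = 2 * 2 * xi / ((xi - 1) * (xi + 1) ^+ 2) by rewrite /s; ring.
by rewrite !mulf_neq0 ?invr_eq0 ?mulf_neq0 ?expf_neq0.
Qed.

Let p0 : p != 0.
Proof. by rewrite mulf_neq0 // oppr_eq0. Qed.

Let p_s0 : p + s != 0.
Proof.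
have -> : p + s = - (xi - 1) * s by rewrite /p; ring.
by rewrite mulf_neq0 // oppr_eq0.
Qed.

Let R_on_curve : on_curve E Rc.
Proof. by apply/eqP; rewrite weq_short /p /s; field; rewrite ?xi1 ?xi2. Qed.

Let Q_on_curve : on_curve E Qc.
Proof. by apply/eqP; rewrite weq_short; ring. Qed.

Let negE x y : neg_coords E (Some (x, y)) = Some (x, - y).
Proof. by rewrite /= mul0r !subr0. Qed.

Let RR : add_coords E Rc Rc = Qc.
Proof.
apply: (@add_tangent _ _ _ _ (1 + s)); try ring.
by apply: mulf_neq0 two0 _; apply: mulf_neq0.
Qed.

Let QQ : add_coords E Qc Qc = neg_coords E Rc.
Proof.
rewrite negE; apply: (@add_tangent _ _ _ _ l); first exact: mulf_neq0;
  by rewrite /l /p /s; field; rewrite ?xi1 ?xi2 ?xi0 ?two0.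
Qed.

(** This and [RNQ] reuse the tangent slopes: the tangent at Q passes through R, and the tangent at R
    passes through - Q. *)
Let RQ : add_coords E Rc Qc = neg_coords E Qc.
Proof.
rewrite negE; apply: (@add_secant _ _ _ _ l) => //;
  by rewrite /l /p /s; field; rewrite ?xi1 ?xi2 ?xi0 ?two0.
Qed.

Let RNQ : add_coords E Rc (neg_coords E Qc) = neg_coords E Rc.
Proof.
rewrite !negE; apply: (@add_secant _ _ _ _ (1 + s)) => //; ring.
Qed.

Lemma five_torsion : exists A : nat -> point E,
  (forall i j, A (i + j) = ec_add (A i) (A j)) /\
  (forall i, A i = ecO E <-> (5 %| i)%N).
Proof.
apply: (@cyclic5 _ _ (Point R_on_curve) (Point Q_on_curve)) => //.
- exact/coords_inj/RR.
- exact/coords_inj/QQ.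
- exact/coords_inj/RQ.
- exact/coords_inj/RNQ.
Qed.

End FiveTorsion.

(** * From the parameters to the subgroup *)

Lemma curve5_has_subgroup (K : fieldType) (xi eta : K) :
  (2 : K) != 0 -> eta ^+ 2 = xi * (xi ^+ 2 + xi - 1) -> ~ excluded5 xi eta ->
  elliptic (curve5 xi eta) ->
  has_subgroup_isog (curve5 xi eta) ('Z_10 * 'Z_2)%type.
Proof.
move=> two0 rel nexc ell.
(* On the parameter curve, xi = 0 forces eta = 0 and xi = 1 or - 1 forces eta^2 = 1, so these three
   values of xi occur only at excluded points. *)
have xi0 : xi != 0.
  apply/negP => /eqP e; apply: nexc; left; move: rel; rewrite e mul0r.
  by move/eqP; rewrite expf_eq0 /= => /eqP ->; rewrite !inE eqxx.
have sq1 : eta ^+ 2 = 1 -> eta = 1 \/ eta = -1.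
  by move/eqP; rewrite sqrf_eq1 => /orP[/eqP|/eqP]; [left|right].
have xi1 : xi - 1 != 0.
  apply/negP; rewrite subr_eq0 => /eqP e; apply: nexc; left; move: rel.
  rewrite e expr1n mul1r addrK => /sq1 [] ->; by rewrite !inE eqxx ?orbT.
have xi2 : xi + 1 != 0.
  apply/negP; rewrite addr_eq0 => /eqP e; apply: nexc; left; move: rel.
  rewrite e sqrrN expr1n subrr sub0r mulrNN mulr1 => /sq1 [] ->;
  by rewrite !inE eqxx ?orbT.
move: ell; rewrite /curve5; set d := xi ^+ 3 + _ - _ - _.
have ed : d = (xi - 1) * (xi + 1) ^+ 2 by rewrite /d; ring.
set al := 2 * xi * (1 - eta) / d; set be := 2 * xi * (1 + eta) / d => ell.
set s := 4 * xi / ((xi - 1) * (xi + 1) ^+ 2); set p := - xi * s.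
have hs : al + be = s by rewrite /al /be ed /s; field; rewrite ?xi1 ?xi2.
have hp : al * be = p.
  have -> : al * be = 4 * xi ^+ 2 * (1 - eta ^+ 2) / d ^+ 2.
    by rewrite /al /be ed; field; rewrite ?xi1 ?xi2.
  by rewrite rel ed /p /s; field; rewrite ?xi1 ?xi2.
have eE : split_cubic (al ^+ 2) (be ^+ 2) 1
    = WCurve 0 (s ^+ 2 - 2 * p + 1) 0 (p ^+ 2 + s ^+ 2 - 2 * p) (p ^+ 2).
  by apply: wcurve_ext => //=; rewrite -?hs -?hp; ring.
move: (ell); rewrite /elliptic disc_split_cubic mulf_eq0 expf_eq0 /=.
rewrite !mulf_eq0 !negb_or => /andP[_ /andP[/andP[d12 d13] d23]].
(* Nonsingularity makes al^2 and be^2 different from 1. The factor p + s + 1 of y(R) is thereby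
   nonzero. *)
have ps0 : p + s + 1 != 0.
  have -> : p + s + 1 = (al + 1) * (be + 1) by rewrite -hs -hp; ring.
  move: d13 d23; rewrite !subr_sqr_1 !mulf_eq0 !negb_or.
  by move=> /andP[_ ->] /andP[_ ->].
have [A [AD A0]] : exists A : nat -> point (split_cubic (al ^+ 2) (be ^+ 2) 1),
    (forall i j, A (i + j) = ec_add (A i) (A j)) /\
    (forall i, A i = ecO _ <-> (5 %| i)%N).
  by rewrite eE; apply: five_torsion.
have on1 : on_curve (split_cubic (al ^+ 2) (be ^+ 2) 1) (Some (- al ^+ 2, 0)).
  by apply/eqP; rewrite weq_split_cubic; ring.
have on2 : on_curve (split_cubic (al ^+ 2) (be ^+ 2) 1) (Some (- be ^+ 2, 0)).
  by apply/eqP; rewrite weq_split_cubic; ring.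
have as1 : associates (Point on1) by apply: (split_cubic_associates two0).
have as2 : associates (Point on2).
  apply: (@split_cubic_associates _ two0 _ (be ^+ 2) (al ^+ 2) 1) => //.
  by apply: wcurve_ext => //=; ring.
have dbl x h : ec_add (@Point _ (split_cubic (al ^+ 2) (be ^+ 2) 1)
    (Some (x, 0)) h) (Point h) = ecO _.
  by apply: val_inj; rewrite /= eqxx mul0r !subr0 oppr0 eqxx.
have T12 : Point on1 <> Point on2.
  move/(congr1 val) => /= [] /oppr_inj e.
  by move: d12; rewrite e subrr eqxx.
exact: (ten_two_subgroup AD A0 as1 as2 (dbl _ on1) (dbl _ on2) _ _ T12).
Qed.

(** * Algebra of the halving roots and of the parameters *)

Section CubicAlgebra.
Variable K : fieldType.
Hypothesis two0 : (2 : K) != 0.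

(** By divided differences: [g z z'] is (f z - f z') / (z - z'), and g z1 z2 - g z1 z3 = (z2 - z3)
    (a + z1 + z2 + z3). *)
Lemma cubic_vieta (a b c z1 z2 z3 : K) :
  z1 != z2 -> z1 != z3 -> z2 != z3 ->
  z1 ^+ 3 + a * z1 ^+ 2 + b * z1 + c = 0 ->
  z2 ^+ 3 + a * z2 ^+ 2 + b * z2 + c = 0 ->
  z3 ^+ 3 + a * z3 ^+ 2 + b * z3 + c = 0 ->
  [/\ a = - (z1 + z2 + z3), b = z1 * z2 + z1 * z3 + z2 * z3
    & c = - (z1 * z2 * z3)].
Proof.
rewrite -(subr_eq0 z1 z2) -(subr_eq0 z1 z3) -(subr_eq0 z2 z3).
move=> d12 d13 d23 h1 h2 h3.
pose f z := z ^+ 3 + a * z ^+ 2 + b * z + c.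
pose g z z' := z ^+ 2 + z * z' + z' ^+ 2 + a * (z + z') + b.
have gP z z' : z - z' != 0 -> f z = 0 -> f z' = 0 -> g z z' = 0.
  move=> d hz hz'; apply: (mulfI d); rewrite mulr0.
  transitivity (f z - f z'); first by rewrite /f /g; ring.
  by rewrite hz hz' subrr.
have ea : a = - (z1 + z2 + z3).
  apply/eqP; rewrite -addr_eq0; apply/eqP/(mulfI d23); rewrite mulr0.
  transitivity (g z1 z2 - g z1 z3); first by rewrite /g; ring.
  by rewrite (gP _ _ d12) // (gP _ _ d13) // subrr.
have eb : b = z1 * z2 + z1 * z3 + z2 * z3.
  apply/eqP; rewrite -subr_eq0; apply/eqP.
  by transitivity (g z1 z2); [rewrite /g ea; ring | apply: gP].
split=> //; apply/eqP; rewrite -subr_eq0; apply/eqP.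
by transitivity (f z1); first by rewrite /f ea eb; ring.
Qed.

(* At a root e of the cubic, x(2P) - e is the square of l - y / (x - e), where l
   is the slope of the tangent at P = (x, y). *)
Lemma double_sub_root (a b c e l x y x' : K) :
  e ^+ 3 + a * e ^+ 2 + b * e + c = 0 ->
  y ^+ 2 = x ^+ 3 + a * x ^+ 2 + b * x + c -> y != 0 ->
  l * (2 * y) = 3 * x ^+ 2 + 2 * a * x + b -> x' = l ^+ 2 - a - x - x ->
  x - e != 0 /\ x' - e = (l - y / (x - e)) ^+ 2.
Proof.
move=> he hy y0 hl ->.
have hy' : y ^+ 2
    = (x - e) * (x ^+ 2 + x * e + e ^+ 2 + a * (x + e) + b).
  by rewrite hy -[LHS]subr0 -he; ring.
have d0 : x - e != 0.
  by apply: contraNneq y0 => d0; rewrite -sqrf_eq0 hy' d0 mul0r.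
split=> //; rewrite sqrrB expr_div_n hy'.
have -> : l * (y / (x - e)) *+ 2 = l * (2 * y) / (x - e) by field.
by rewrite hl; field.
Qed.

(** The last hypothesis is the abscissa part of 2Q = - R with the tangent slope at Q eliminated. It
    is homogeneous of degree 8 in the [ri], so only the ratios to [r3] matter. *)
Lemma curve5_parameters (r1 r2 r3 : K) :
  r1 != 0 -> r2 != 0 -> r3 != 0 -> r1 != r2 ->
  r1 * r2 + r1 * r3 + r2 * r3 != 0 ->
  ((r1 * r2) ^+ 2 + (r1 * r3) ^+ 2 + (r2 * r3) ^+ 2) ^+ 2
  = 4 * (r1 * r2 * r3) ^+ 2
    * (r1 * r2 + r1 * r3 + r2 * r3 + r1 ^+ 2 + r2 ^+ 2 + r3 ^+ 2) ->
  exists xi eta : K, let d := xi ^+ 3 + xi ^+ 2 - xi - 1 in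
    [/\ eta ^+ 2 = xi * (xi ^+ 2 + xi - 1), ~ excluded5 xi eta,
        2 * xi * (1 - eta) / d = r1 / r3
      & 2 * xi * (1 + eta) / d = r2 / r3].
Proof.
move=> r10 r20 r30 ne12 s20 h; set al := r1 / r3; set be := r2 / r3.
have er1 : r1 = al * r3 by rewrite divfK.
have er2 : r2 = be * r3 by rewrite divfK.
have al0 : al != 0 by rewrite mulf_neq0 ?invr_eq0.
have be0 : be != 0 by rewrite mulf_neq0 ?invr_eq0.
set s := al + be; set p := al * be.
have p0 : p != 0 by rewrite mulf_neq0.
have ps0 : p + s != 0.
  apply: contraNneq s20 => e; rewrite er1 er2.
  have -> : al * r3 * (be * r3) + al * r3 * r3 + be * r3 * r3
    = (p + s) * r3 ^+ 2 by rewrite /p /s; ring.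
  by rewrite e mul0r.
have hsp : (p + s) * (p - s) ^+ 2 - 4 * p * s = 0.
  have r80 : r3 ^+ 8 != 0 by rewrite expf_neq0.
  apply: (mulfI ps0); apply: (mulfI r80); rewrite !mulr0.
  transitivity (((r1 * r2) ^+ 2 + (r1 * r3) ^+ 2 + (r2 * r3) ^+ 2) ^+ 2
    - 4 * (r1 * r2 * r3) ^+ 2
    * (r1 * r2 + r1 * r3 + r2 * r3 + r1 ^+ 2 + r2 ^+ 2 + r3 ^+ 2)).
    by rewrite er1 er2 /p /s; ring.
  by rewrite h subrr.
have s0 : s != 0.
  apply: contraNneq p0 => e; move: hsp; rewrite e mulr0 !subr0 addr0 => /eqP.
  by rewrite -exprS expf_eq0.
have disc_s : (be - al) ^+ 2 = s ^+ 2 - 4 * p by rewrite /s /p; ring.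
have ab : be - al != 0.
  rewrite subr_eq0; apply: contraNneq ne12 => e; apply/eqP.
  by rewrite er1 er2 e.
have eal : s - (be - al) = 2 * al by rewrite /s; ring.
have ebe : s + (be - al) = 2 * be by rewrite /s; ring.
move: (be - al) disc_s ab eal ebe => t disc_s t0 eal ebe.
set xi := - p / s; set eta := t / s; exists xi, eta => d.
have ep : p = - xi * s by rewrite /xi; field.
have xi0 : xi != 0 by rewrite mulf_neq0 ?invr_eq0 ?oppr_eq0.
have four0 : (4 : K) != 0.
  have -> : (4 : K) = 2 * 2 by ring.
  by rewrite mulf_neq0.
(* With p = - xi s, the left-hand side of [hsp] equals - s^2 (s d - 4 xi). *)
have hd : s * d = 4 * xi.
  apply: (mulfI (expf_neq0 2 s0)); apply/eqP.
  rewrite -subr_eq0 -oppr_eq0 -[X in _ == X]hsp; apply/eqP.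
  by rewrite ep /d; ring.
have d0 : d != 0.
  by apply/negP => /eqP e; move: (mulf_neq0 four0 xi0); rewrite -hd e mulr0 eqxx.
(* Since t^2 = s^2 - 4 p, eta^2 = 1 + 4 xi / s = 1 + d. *)
have rel : eta ^+ 2 = xi * (xi ^+ 2 + xi - 1).
  have -> : eta ^+ 2 = 1 + s * (4 * xi) / s ^+ 2.
    by rewrite expr_div_n disc_s ep; field.
  by rewrite -hd /d; field.
have ex : 2 * xi = s * d / 2 by rewrite hd; field.
split=> //.
(* The family with eta = 0 is ruled out by al <> be, and the points with xi = 1 or - 1 by d <> 0. *)
- case=> [|[_ /eqP]]; last by rewrite /eta mulf_eq0 invr_eq0 (negPf t0) (negPf s0).
  rewrite !inE !xpair_eqE (negPf xi0) /= => e.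
  have : d = (xi - 1) * (xi + 1) ^+ 2 by rewrite /d; ring.
  move/eqP; apply/negP; move: d0; apply: contraNneq => ->.
  case/or4P: e => /andP[/eqP -> _]; by rewrite ?subrr ?addNr ?mul0r ?expr0n ?mulr0.
- have -> : 2 * xi * (1 - eta) / d = (s - t) / 2.
    by rewrite ex /eta; field; rewrite ?d0 ?s0 ?two0.
  by rewrite eal; field.
- have -> : 2 * xi * (1 + eta) / d = (s + t) / 2.
    by rewrite ex /eta; field; rewrite ?d0 ?s0 ?two0.
  by rewrite ebe; field.
Qed.

End CubicAlgebra.

(** * From the subgroup to the parameters *)

Section ShortModelTorsion.
Variables (K : fieldType) (a b c : K).
Hypothesis two0 : (2 : K) != 0.
Let E := WCurve 0 a 0 b c.

Lemma short_two_torsion (P : point E) : P <> ecO E -> ec_add P P = ecO E ->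
  exists e, coords P = Some (e, 0) /\ e ^+ 3 + a * e ^+ 2 + b * e + c = 0.
Proof.
case: P => [[[x y]|] h] nO; last by case: nO; apply: coords_inj.
move/ec_add_eqO/(congr1 (@coords K E)) => /= [].
rewrite mul0r !subr0 => /eqP; rewrite -addr_eq0 -mulr2n -mulr_natl mulf_eq0.
rewrite (negPf two0) /= => /eqP y0; exists x; clear nO; subst y; split=> //.
move: h => /= /eqP; rewrite weq_short expr0n /= sub0r => /eqP.
by rewrite oppr_eq0 => /eqP.
Qed.

Lemma add_tangent_inv (x y x' y' : K) :
  add_coords E (Some (x, y)) (Some (x, y)) = Some (x', y') ->
  y != 0 /\ exists l : K, [/\ l * (2 * y) = 3 * x ^+ 2 + 2 * a * x + b,
    x' = l ^+ 2 - a - x - x & y' = l * (x - x') - y].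
Proof.
rewrite /= eqxx /= !mul0r !addr0 !subr0; case: eqP => // ne [<- <-].
have y0 : y != 0 by apply/eqP => y0; case: ne; rewrite y0 oppr0.
split=> //; exists ((3 * x ^+ 2 + 2 * a * x + b) / (2 * y)).
by split; [rewrite divfK // mulf_neq0 | ring | ring].
Qed.

Lemma wisomorphic_curve5_of_halving (e1 e2 e3 x0 y0 x1 y1 : K) :
  e1 != e2 -> e1 != e3 -> e2 != e3 ->
  e1 ^+ 3 + a * e1 ^+ 2 + b * e1 + c = 0 ->
  e2 ^+ 3 + a * e2 ^+ 2 + b * e2 + c = 0 ->
  e3 ^+ 3 + a * e3 ^+ 2 + b * e3 + c = 0 ->
  on_curve E (Some (x0, y0)) -> x0 != x1 ->
  add_coords E (Some (x0, y0)) (Some (x0, y0)) = Some (x1, y1) ->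
  add_coords E (Some (x1, y1)) (Some (x1, y1)) = Some (x0, - y0) ->
  exists xi eta : K,
    [/\ eta ^+ 2 = xi * (xi ^+ 2 + xi - 1), ~ excluded5 xi eta
      & wisomorphic E (curve5 xi eta)].
Proof.
move=> n12 n13 n23 h1 h2 h3 on0 n01 RR QQ.
have [y00 [l [hl ex1 ey1]]] := add_tangent_inv RR.
have [y10 [l' [hl' ex0 _]]] := add_tangent_inv QQ.
have on0' : y0 ^+ 2 = x0 ^+ 3 + a * x0 ^+ 2 + b * x0 + c.
  by move: on0 => /= /eqP; rewrite weq_short => /eqP; rewrite subr_eq0 => /eqP.
pose r e := l - y0 / (x0 - e).
(* Substituting e = x1 - r^2 into (r - l) (x0 - e) + y0 = 0 yields a monic cubic for r = [r e] whose
   coefficients do not depend on e. The three values [r ei] are thus its roots, and Vieta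
   applies. *)
have rP e : e ^+ 3 + a * e ^+ 2 + b * e + c = 0 ->
  x1 - e = r e ^+ 2 /\
  r e ^+ 3 + - l * r e ^+ 2 + (x0 - x1) * r e + - y1 = 0.
  move=> he; have [d0 hr] := double_sub_root he on0' y00 hl ex1.
  split=> //; have -> : r e ^+ 3 + - l * r e ^+ 2 + (x0 - x1) * r e + - y1
    = (r e - l) * (r e ^+ 2 - (x1 - e)) + ((r e - l) * (x0 - e) + y0)
      + (l * (x0 - x1) - y0 - y1) by ring.
  by rewrite hr subrr mulr0 add0r -ey1 subrr addr0 /r; field.
have [[q1 k1] [q2 k2] [q3 k3]] := And3 (rP _ h1) (rP _ h2) (rP _ h3).
have rne e e' : e != e' -> x1 - e = r e ^+ 2 -> x1 - e' = r e' ^+ 2 ->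
    r e ^+ 2 != r e' ^+ 2.
  move=> ne <- <-; apply: contraNneq ne => /addrI /oppr_inj ->.
  by rewrite eqxx.
have rne1 e e' : r e ^+ 2 != r e' ^+ 2 -> r e != r e'.
  by apply: contraNneq => ->.
have m12 := rne _ _ n12 q1 q2; have m13 := rne _ _ n13 q1 q3.
have m23 := rne _ _ n23 q2 q3.
have [el ex ey] := cubic_vieta (rne1 _ _ m12) (rne1 _ _ m13) (rne1 _ _ m23) k1 k2 k3.
have [ea eb ec] := cubic_vieta n12 n13 n23 h1 h2 h3.
move: (r e1) (r e2) (r e3) q1 q2 q3 m12 el ex ey => r1 r2 r3 q1 q2 q3 m12 el ex ey.
have {}ey : y1 = r1 * r2 * r3 by apply: oppr_inj.
have [r10 r20 r30] : [/\ r1 != 0, r2 != 0 & r3 != 0].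
  by move: y10; rewrite ey !mulf_eq0 !negb_or => /andP[/andP[-> ->] ->].
have ee1 : e1 = x1 - r1 ^+ 2 by rewrite -q1; ring.
have ee2 : e2 = x1 - r2 ^+ 2 by rewrite -q2; ring.
have ee3 : e3 = x1 - r3 ^+ 2 by rewrite -q3; ring.
(* The numerator of the tangent slope is the derivative of (x - e1) (x - e2) (x - e3) at x1, where
   x1 - ei = ri^2. *)
have hl2 : l' * (2 * y1)
    = (r1 * r2) ^+ 2 + (r1 * r3) ^+ 2 + (r2 * r3) ^+ 2.
  by rewrite hl' ea eb ee1 ee2 ee3; ring.
have hx : l' ^+ 2 = x0 - x1 + r1 ^+ 2 + r2 ^+ 2 + r3 ^+ 2.
  by rewrite ex0 ea ee1 ee2 ee3; ring.
have ne12 : r1 != r2 by apply: contraNneq m12 => ->.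
have s20 : r1 * r2 + r1 * r3 + r2 * r3 != 0 by rewrite -ex subr_eq0.
have [|xi [eta [rel nexc hal hbe]]] :=
    curve5_parameters two0 r10 r20 r30 ne12 s20.
  by rewrite -ex -hl2 -hx ey; ring.
(* Translation by [x1] moves Q to abscissa 0 and the roots to - ri^2; scaling by u = r3 then makes
   the third constant 1. *)
exists xi, eta; split=> //; exists r3, x1, 0, 0; split=> //.
rewrite /curve5 hal hbe.
by apply: wcurve_ext => /=; rewrite ?ec ?eb ?ea ?ee1 ?ee2 ?ee3; field.
Qed.

Lemma has_subgroup_curve5 : has_subgroup_isog E ('Z_10 * 'Z_2)%type ->
  exists xi eta : K,
    [/\ eta ^+ 2 = xi * (xi ^+ 2 + xi - 1), ~ excluded5 xi eta
      & wisomorphic E (curve5 xi eta)].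
Proof.
case/has_subgroup_isogP => f [fI fD].
have f0 : f 0 = ecO E by apply: ec_add_idem; rewrite -fD addr0.
have nO g : g != 0 -> f g <> ecO E.
  by move=> g0; rewrite -f0 => /fI e; rewrite e eqxx in g0.
have two g : g != 0 -> g + g = 0 -> exists e,
    coords (f g) = Some (e, 0) /\ e ^+ 3 + a * e ^+ 2 + b * e + c = 0.
  by move=> g0 gg; apply: short_two_torsion; [apply: nO | rewrite -fD gg f0].
(* [t1], [t2], [t3] are the three elements of order 2; [g2] below has order 5. *)
pose t1 : 'Z_10 * 'Z_2 := (inZp 5, 0); pose t2 : 'Z_10 * 'Z_2 := (0, inZp 1).
pose t3 : 'Z_10 * 'Z_2 := (inZp 5, inZp 1).
pose g2 : 'Z_10 * 'Z_2 := (inZp 2, 0).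
have [||e1 [c1 h1]] := two t1; [by [] | exact/eqP | ].
have [||e2 [c2 h2]] := two t2; [by [] | exact/eqP | ].
have [||e3 [c3 h3]] := two t3; [by [] | exact/eqP | ].
have ne g h e e' : g != h -> coords (f g) = Some (e, 0) ->
    coords (f h) = Some (e', 0) -> e != e'.
  move=> gh cg ch; apply: contraNneq gh => e_; apply/eqP/fI/coords_inj.
  by rewrite cg ch e_.
have RR := fD g2 g2; have QQ := fD (g2 + g2) (g2 + g2).
have g10 : g2 + (g2 + g2 + (g2 + g2)) = 0 by apply/eqP.
have RN : f (g2 + g2 + (g2 + g2)) = ec_neg (f g2).
  by apply: ec_add_eqO; rewrite -fD g10 f0.
rewrite RN in QQ.
have R0 : f g2 <> ecO E by apply: nO.
have Q0 : f (g2 + g2) <> ecO E by apply: nO.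
have neRQ : f g2 <> f (g2 + g2) by move/fI/eqP.
have neRNQ : f (g2 + g2) <> ec_neg (f g2) by rewrite -RN => /fI/eqP.
move: (f g2) (f (g2 + g2)) RR QQ R0 Q0 neRQ neRNQ => R Q.
case: R => [[[x0 y0]|] hR]; last by move=> _ _ []; apply: coords_inj.
case: Q => [[[x1 y1]|] hQ]; last by move=> _ _ _ []; apply: coords_inj.
move=> RR QQ _ _ neRQ neRNQ.
apply: (@wisomorphic_curve5_of_halving e1 e2 e3 x0 y0 x1 y1) => //.
- exact: ne c1 c2.
- exact: ne c1 c3.
- exact: ne c2 c3.
- apply/eqP => ex; subst x1.
  have [ey|ey] := weq_same_abscissa (eqP hQ) (eqP hR).
    by apply: neRQ; apply: coords_inj; rewrite /= ey.
  by apply: neRNQ; apply: coords_inj; rewrite /= ey.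
- exact: (esym (congr1 (@coords K E) RR)).
- rewrite -[RHS](_ : neg_coords E (Some (x0, y0)) = _); last first.
    by rewrite /= mul0r !subr0.
  exact: (esym (congr1 (@coords K E) QQ)).
Qed.

End ShortModelTorsion.

Theorem theorem8p6 (K : fieldType) (char_ne2 : 2%N \notin [pchar K])
    (E : wcurve K) (ellE : elliptic E) :
  has_subgroup_isog E ('Z_10 * 'Z_2)%type
  <->
  exists xi eta : K,
    [/\ eta ^+ 2 = xi * (xi ^+ 2 + xi - 1),
        ~ excluded5 xi eta
      & wisomorphic E (curve5 xi eta)].
Proof.
have two0 : (2 : K) != 0 by rewrite inE in char_ne2.
split=> [sub|[xi [eta [rel nexc iso]]]]; last first.
  apply: wisomorphic_has_subgroup (iso) _; apply: curve5_has_subgroup => //.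
  case: iso => u [r [s [t [u0 ->]]]]; rewrite /elliptic disc_change_vars //.
  by rewrite mulf_neq0 // invr_eq0 expf_neq0.
(* Completing the square in y, possible as 2 is invertible, removes the coefficients [a1] and
   [a3]. *)
set E1 := change_vars E 1 0 (- a1 E / 2) (- a3 E / 2).
have iso : wisomorphic E E1.
  by exists 1, 0, (- a1 E / 2), (- a3 E / 2); split; rewrite ?oner_eq0.
have eE1 : E1 = WCurve 0 (a2 E1) 0 (a4 E1) (a6 E1).
  by apply: wcurve_ext => //=; field; rewrite ?oner_eq0 ?two0.
have sub1 := wisomorphic_has_subgroup (wisomorphic_sym iso) sub.
rewrite eE1 in sub1.
have [xi [eta [rel nexc iso1]]] := has_subgroup_curve5 two0 sub1.
exists xi, eta; split=> //; apply: wisomorphic_trans iso _.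
by rewrite eE1.
Qed.
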